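(* For the merging problem with $n$ items and $k$ slots, let $0<\epsilon<1$ and suppose $n\ge k^2/\epsilon+k$ and the ad values $a_1,\dots,a_n$ are i.i.d. with a common (regular) distribution supported on $[0,\infty)$, and $o_i\ge0$. Then the G-FIX mechanism is $(1-\epsilon)$-approximate: $\mathrm{OBJ}(\mathcal M^F)\ge(1-\epsilon)\mathrm{OBJ}(\mathcal M^* )$.
   Context: Merging problem: $n$ items indexed by $[n]$, $k\le n$ slots. Each item $i$ has a random ad value $a_i$, drawn independently from a regular distribution $G_i$ ($\boldsymbol a\sim G=\times_i G_i$), and a fixed organic value $o_i\ge0$. A mechanism is a pair of allocation rules $x,y$ with $x_i(\boldsymbol a),y_i(\boldsymbol a)\in\{0,1\}$ ($x_i=1$: item $i$ shown as ad; $y_i=1$: shown organically) satisfying for all $\boldsymbol a,i$: (i) $\sum_i(x_i+y_i)\le k$; (ii) $x_i+y_i\le 1$; (iii) $y_i(a_i,\boldsymbol a_{-i})$ independent of $a_i$; (iv) $x_i(a_i,\boldsymbol a_{-i})$ non-decreasing in $a_i$. Objective $\mathrm{OBJ}=\mathbb E_{\boldsymbol a\sim G}[\sum_i(a_ix_i(\boldsymbol a)+o_iy_i(\boldsymbol a))]$; $\mathcal M^*$ maximizes it subject to (i)–(iv). A mechanism $\mathcal M$ is $\tau$-approximate if $\mathrm{OBJ}(\mathcal M)/\mathrm{OBJ}(\mathcal M^* )\ge\tau$. Notation: for a finite multiset $S$ of reals and $k\le|S|$, $\max^{(k)}S$ is the sum of the $k$ largest elements of $S$. G-FIX-$I$ mechanism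 $\mathcal M^F_I$ for $I\subseteq[n]$: items in $I$ may only be shown in organic form and items outside $I$ only as ads; with $L=\{o_i:i\in I\}\cup\{a_i:i\in[n]\setminus I\}$, it displays (in the designated forms) the $k$ items with the largest values in $L$. Its objective is $\mathrm{OBJ}(\mathcal M_I^F)=\mathbb E_{\boldsymbol a\sim G}[\max^{(k)}L]$. The G-FIX mechanism $\mathcal M^F$ runs the $\mathcal M^F_I$ with the highest objective among all $I\subseteq[n]$ with $|I|\le k$, so $\mathrm{OBJ}(\mathcal M^F)=\max_{I\subseteq[n],|I|\le k}\mathrm{OBJ}(\mathcal M^F_I)$. *)

(* Defs.v *)
From HB Require Import structures.
From mathcomp Require Import all_boot all_order all_algebra.
From mathcomp Require Import all_classical all_reals all_analysis.
Set Implicit Arguments. Unset Strict Implicit. Unset Printing Implicit Defensive.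
Import Order.TTheory GRing.Theory Num.Theory.
Local Open Scope classical_set_scope.
Local Open Scope ring_scope.

Section Merging.
Variables (R : realType) (n : nat).

Definition upd (a : n.-tuple R) (i : 'I_n) (v : R) : n.-tuple R :=
  [tuple if j == i then v else tnth a j | j < n].

Definition topk (k : nat) (s : seq R) : R :=
  \sum_(v <- take k (sort (fun u w : R => w <= u) s)) v.

(** A mechanism: allocation rules x (ad) and y (organic), conditions (i)-(iv);
    allocations are required to be (Borel) measurable so that OBJ is defined. *)
Definition feasible_mechanism (k : nat)
    (x y : n.-tuple R -> 'I_n -> bool) : Prop :=
  [/\ (forall a, (\sum_(i < n) (x a i + y a i) <= k)%N),
      (forall a i, ~~ (x a i && y a i)),
      (forall a i v w, y (upd a i v) i = y (upd a i w) i),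
      (forall a i v w, v <= w -> (x (upd a i v) i <= x (upd a i w) i)%N) &
      (forall i, measurable_fun setT (fun a => x a i) /\
                 measurable_fun setT (fun a => y a i))].

End Merging.

Section Prob.
Context {R : realType} {d : measure_display} {T : measurableType d}.
Variables (P : probability T R) (n : nat).

Definition indep_coords (a : T -> n.-tuple R) : Prop :=
  forall B : 'I_n -> set R, (forall i, measurable (B i)) ->
    P (\bigcap_(i in [set: 'I_n]) (fun w => tnth (a w) i) @^-1` B i)
    = (\prod_(i < n) P ((fun w => tnth (a w) i) @^-1` B i))%E.

Definition coords_distributed (a : T -> n.-tuple R) (G : probability R R) : Prop :=
  forall i (B : set R), measurable B ->
    P ((fun w => tnth (a w) i) @^-1` B) = G B.

Definition OBJ (o : 'I_n -> R) (a : T -> n.-tuple R)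
    (x y : n.-tuple R -> 'I_n -> bool) : \bar R :=
  'E_P[fun w => \sum_(i < n) (tnth (a w) i * (x (a w) i)%:R
                               + o i * (y (a w) i)%:R)].

Definition Llist (o : 'I_n -> R) (I : {set 'I_n}) (av : n.-tuple R) : seq R :=
  [seq (if i \in I then o i else tnth av i) | i <- enum 'I_n].

Definition OBJ_FIX (k : nat) (o : 'I_n -> R) (a : T -> n.-tuple R)
    (I : {set 'I_n}) : \bar R :=
  'E_P[fun w => topk k (Llist o I (a w))].

Definition OBJ_GFIX (k : nat) (o : 'I_n -> R) (a : T -> n.-tuple R) : \bar R :=
  \big[Order.max/-oo%E]_(I : {set 'I_n} | (#|I| <= k)%N) OBJ_FIX k o a I.

End Prob.

(** Regular distribution on R: it has a (Lebesgue) density g, and the virtual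
    value phi(v) = v - (1 - F(v)) / g(v) is nondecreasing where g > 0. *)
Definition regular_distribution {R : realType} (G : probability R R) : Prop :=
  exists g : R -> R,
    [/\ (forall v, 0 <= g v), measurable_fun setT g,
        (forall B : set R, measurable B ->
           G B = (\int[lebesgue_measure]_(v in B) (g v)%:E)%E) &
        (forall v w, 0 < g v -> 0 < g w -> v <= w ->
           v - (1 - fine (G [set` `]-oo, v]])) / g v <= w - (1 - fine (G [set` `]-oo, w]])) / g w)].

(* Main.v *)
(** The pointwise value of any feasible mechanism is at most the sum of the [k]
    largest elements of {all ads} + {the [k] best organic items}. Let [I] be the
    set of the [k] best organic items; the mechanism [M_I] loses against this bound
    only because the ads of the items of [I] are unavailable. The ad values are
    exchangeable, so [I] may be replaced on the ad side by its [n] cyclic shifts: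
    every ad is lost in exactly [k] of them, hence averaging gives
    [OBJ(M_I) >= (1 - k/n) OBJ(M)], and [k/n <= eps]. *)

Require Import Defs.
From HB Require Import structures.
From mathcomp Require Import all_boot all_order all_algebra fingroup perm.
From mathcomp Require Import all_classical all_reals all_analysis.
From mathcomp Require Import measurable_realfun.
Import Order.TTheory GRing.Theory Num.Theory.
Local Open Scope classical_set_scope.
Local Open Scope ring_scope.

(** * Index sets of the [k] largest values and the sums over them *)

(** Indices are selected rather than values: the sort settles ties, so the cardinality is [minn k n]
    for every [f], and the sets are nested in [k] as prefixes of one list. *)
Definition topset {R : realType} {n : nat} (f : 'I_n -> R) (k : nat) : {set 'I_n} :=
  [set i in take k (sort (fun i j => f j <= f i) (enum 'I_n))]%SET.

Section TopSet.
Context {R : realType} {n : nat}.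
Implicit Types (f : 'I_n -> R) (S t : {set 'I_n}).

Lemma card_topset f k : #|topset f k| = minn k n.
Proof.
rewrite /topset cardsE (card_uniqP _).
  by rewrite size_take_min size_sort size_enum_ord.
by rewrite take_uniq // sort_uniq enum_uniq.
Qed.

Lemma topset_ge f k i j :
  i \in topset f k -> j \notin topset f k -> f j <= f i.
Proof.
set r := fun i j => f j <= f i; rewrite !inE -/r => hi hj.
have trr : transitive r by move=> u v w vu uw; exact: le_trans uw vu.
have tot : total r by move=> u v; exact: le_total.
have := sort_sorted tot (enum 'I_n).
rewrite (sorted_pairwise trr) -(cat_take_drop k (sort r _)) pairwise_cat.
case/andP => /allrelP + _; apply => //.
have : j \in sort r (enum 'I_n) by rewrite mem_sort mem_enum.
by rewrite -{1}(cat_take_drop k (sort r _)) mem_cat (negPf hj).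
Qed.

Lemma topset_sub f k l : (k <= l)%N -> {subset topset f k <= topset f l}.
Proof.
move=> kl i; rewrite !inE => hi.
by rewrite -(take_takel _ kl) in hi; exact: mem_take hi.
Qed.

Lemma topk_map_enum f k :
  topk k [seq f i | i <- enum 'I_n] = \sum_(i in topset f k) f i.
Proof.
rewrite /topk sort_map -map_take big_map big_uniq /=; last first.
  by rewrite take_uniq // sort_uniq enum_uniq.
by apply: eq_bigl => i; rewrite inE.
Qed.

(** After the common part [S :&: t] is cancelled, [c], the maximum of 0 and the values outside [t],
    separates the sums: it bounds the terms over [S :\: t] from above and those over [t :\: S], at
    least as numerous, from below. *)
Lemma sum_le_dominating f S t : (forall i, 0 <= f i) -> (#|S| <= #|t|)%N ->
  (forall i j, i \in t -> j \notin t -> f j <= f i) ->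
  \sum_(i in S) f i <= \sum_(i in t) f i.
Proof.
move=> f0 St dom.
rewrite (big_setID t) /= [leRHS](big_setID S) /= finset.setIC lerD2l.
pose c := \big[Num.max/0]_(j | j \notin t) f j.
have c0 : 0 <= c by apply: bigmax_ge_id.
apply: (@le_trans _ _ (c *+ #|(S :\: t)%SET|)).
  rewrite -sumr_const; apply: ler_sum => j; rewrite finset.in_setD => /andP[jt _].
  exact: le_bigmax_cond.
apply: (@le_trans _ _ (c *+ #|(t :\: S)%SET|)).
  apply: ler_wpMn2l => //; rewrite -(leq_add2l #|(S :&: t)%SET|) cardsID.
  by rewrite finset.setIC cardsID.
rewrite -sumr_const; apply: ler_sum => i; rewrite finset.in_setD => /andP[_ it].
by apply: bigmax_le => // j jt; exact: dom.
Qed.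

Lemma sum_le_topset f S k : (forall i, 0 <= f i) -> (#|S| <= k)%N ->
  \sum_(i in S) f i <= \sum_(i in topset f k) f i.
Proof.
move=> f0 Sk; apply: sum_le_dominating => //; last exact: topset_ge.
by rewrite card_topset leq_min Sk; have := max_card (mem S); rewrite card_ord.
Qed.

(** [\big[Num.max/x]] needs an initial value below the maximum: the sum over any
    set of the right cardinality will do. *)
Lemma topk_bigmax f k :
  topk k [seq f i | i <- enum 'I_n] =
  \big[Num.max/(\sum_(i in topset (fun=> 0 : R) k) f i)]_(S : {set 'I_n} | #|S| == minn k n)
     \sum_(i in S) f i.
Proof.
rewrite topk_map_enum.
have le_top S : #|S| == minn k n ->
    \sum_(i in S) f i <= \sum_(i in topset f k) f i.
  (* Adding a constant makes [f] nonnegative and is harmless, the cardinalities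
     being equal. *)
  move=> /eqP cS; pose C := \sum_i `|f i|.
  have : \sum_(i in S) (f i + C) <= \sum_(i in topset f k) (f i + C).
    apply: sum_le_dominating; rewrite ?cS ?card_topset //.
      move=> i; rewrite addrC -lerBlDr sub0r.
      apply: (le_trans (ler_norm _)); rewrite normrN /C (bigD1 i) //= lerDl.
      exact: sumr_ge0.
    by move=> i j it jt; rewrite lerD2r; exact: topset_ge jt.
  by rewrite !big_split /= !sumr_const cS card_topset lerD2r.
apply/le_anti/andP; split.
  by apply: le_bigmax_cond; rewrite card_topset.
by apply: bigmax_le => [|S]; [apply: le_top; rewrite card_topset|exact: le_top].
Qed.

End TopSet.

(** * Averaging over cyclic shifts for one realization of the ads *)

(** Here [X] and [Y] stand for the items a mechanism shows as ads and organically. Addition in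
    ['I_m.+1] is modulo [m.+1], so [v (i + j)] is a cyclic shift of the ads. *)
Lemma sum_shifts_ge {R : realType} {m : nat} (k : nat) (o v : 'I_m.+1 -> R)
    (X Y : {set 'I_m.+1}) :
  (forall i, 0 <= o i) -> (forall i, 0 <= v i) ->
  (k <= m.+1)%N -> (#|X| + #|Y| <= k)%N ->
  (m.+1 - k)%:R * (\sum_(i in X) v i + \sum_(i in Y) o i) <=
  \sum_(j < m.+1) topk k [seq if i \in topset o k then o i else v (i + j)
                         | i <- enum 'I_m.+1].
Proof.
(* [Y] need not lie in [I]; the [#|Y|] best organic items do, and they are worth at least as
   much. *)
move=> o0 v0 kn XYk; set I := topset o k; set Y' := topset o #|Y|.
have Y'I : Y' \subset I.
  apply/fintype.subsetP; apply: topset_sub.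
  by apply: leq_trans XYk; exact: leq_addl.
(* With the ads shifted by [j], show [Y'] organically and the ads of [X] that
   remain available. *)
have shift j : \sum_(i in Y') o i + \sum_(i in X | (i - j) \notin I) v i <=
    topk k [seq if i \in I then o i else v (i + j) | i <- enum 'I_m.+1].
  pose Z : {set 'I_m.+1} := [set i | (i + j \in X) && (i \notin I)]%SET.
  have dYZ : [disjoint Y' & Z]%bool.
    rewrite disjoint_subset; apply/fintype.subsetP => i iY; rewrite inE inE.
    by rewrite negb_and negbK (fintype.subsetP Y'I) ?orbT.
  have -> : \sum_(i in X | (i - j) \notin I) v i = \sum_(i in Z) v (i + j).
    rewrite (reindex_inj (addIr j)) /=; apply: eq_bigl => i.
    by rewrite !inE addrK.
  have -> : \sum_(i in Y') o i + \sum_(i in Z) v (i + j) =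
      \sum_(i in (Y' :|: Z)%SET) if i \in I then o i else v (i + j).
    rewrite (eq_bigl _ _ (fun i => finset.in_setU i Y' Z)) bigU //=.
    congr (_ + _); apply: eq_bigr => i.
      by move=> iY; rewrite (fintype.subsetP Y'I).
    by rewrite inE => /andP[_ /negPf ->].
  rewrite topk_map_enum; apply: sum_le_topset => [i|]; first by case: ifP.
  rewrite cardsU disjoint_setI0 // cards0 subn0.
  (* Translation by [j] embeds [Z] into [X], so [Y'] and [Z] together fit into the [k] slots. *)
  apply: leq_trans XYk; rewrite addnC; apply: leq_add.
    rewrite -(card_imset (mem Z) (addIr j)); apply/subset_leq_card.
    by apply/fintype.subsetP => _ /imsetP[i + ->]; rewrite inE => /andP[].
  by rewrite card_topset geq_minl.
(* Each ad of [X] remains available for exactly [m.+1 - k] shifts [j]. *)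
apply: le_trans (ler_sum _ (fun j _ => shift j)).
have cI : #|~: I| = (m.+1 - k)%N.
  by rewrite cardsCs finset.setCK card_ord card_topset (minn_idPl kn).
have -> : \sum_(j < m.+1) (\sum_(i in Y') o i + \sum_(i in X | (i - j) \notin I) v i)
  = (\sum_(i in Y') o i) *+ m.+1 + (m.+1 - k)%:R * \sum_(i in X) v i.
  rewrite big_split /= sumr_const card_ord; congr (_ + _).
  rewrite (exchange_big_dep (mem X)) /=; last by move=> i j _ /andP[].
  rewrite mulr_sumr; apply: eq_bigr => i iX.
  (* Substituting [j = i - l] turns the condition [i - j \notin I] into [l \notin I]. *)
  rewrite (reindex_inj (subrI i)) /= -cI mulr_natl -sumr_const.
  by apply: eq_bigl => l; rewrite iX finset.in_setC opprB addrC subrK.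
(* The ad terms cancel. The organic sum occurs [m.+1] times on the right and only [m.+1 - k] times
   on the left. *)
rewrite mulrDr addrC lerD2r -[leRHS]mulr_natl.
apply: ler_pM => //; [exact: sumr_ge0|by rewrite ler_nat leq_subr|].
exact: sum_le_topset.
Qed.

(** * Measurability of the sum of the [k] largest values *)

Lemma measurable_bigmaxr {d} {T : measurableType d} {R : realType} {I : Type}
    (s : seq I) (Q : pred I) (c : T -> R) (F : I -> T -> R) :
  measurable_fun setT c -> (forall i, measurable_fun setT (F i)) ->
  measurable_fun setT (fun w => \big[Num.max/c w]_(i <- s | Q i) F i w).
Proof.
move=> mc mF; elim: s => [|i s IHs].
  by under eq_fun do rewrite big_nil.
under eq_fun do rewrite big_cons.
by case: (Q i) => //; exact: measurable_maxr.
Qed.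

(** The sorting order varies with [w], so [topk] is rewritten as a finite maximum of sums over fixed
    index sets; the initial value of that maximum is such a sum too. *)
Lemma measurable_topk {d} {T : measurableType d} {R : realType} {n : nat} (k : nat)
    (F : 'I_n -> T -> R) : (forall i, measurable_fun setT (F i)) ->
  measurable_fun setT (fun w => topk k [seq F i w | i <- enum 'I_n]).
Proof.
move=> mF.
have msum (S : {set 'I_n}) : measurable_fun setT (fun w => \sum_(i in S) F i w).
  under eq_fun do rewrite -big_enum /=.
  exact: measurable_sum.
under eq_fun do rewrite topk_bigmax.
exact: measurable_bigmaxr.
Qed.

(** * Laws of random tuples through rectangles, and exchangeability of i.i.d. coordinates *)

Section RectangleLaw.
Context {R : realType} {n : nat}.

Let rect : set (set (n.-tuple R)) :=
  [set A | exists2 B : 'I_n -> set R, (forall i, measurable (B i)) &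
     A = \bigcap_(i in [set: 'I_n]) (fun b => tnth b i) @^-1` B i].

Let rectI : setI_closed rect.
Proof.
move=> _ _ [A mA ->] [B mB ->]; exists (fun i => A i `&` B i).
  by move=> i; exact: measurableI.
by rewrite -bigcapI.
Qed.

(** A coordinate preimage is a rectangle whose other sides are [setT]; conversely, a rectangle is a
    finite intersection of coordinate preimages. *)
Let measurable_rect : measurable = <<s rect >>.
Proof.
apply/seteqP; split.
  apply: smallest_sub; first exact: smallest_sigma_algebra.
  move=> A; rewrite -bigcup_seq => -[i _ [B mB <-]]; apply: sub_sigma_algebra.
  exists (fun j => if j == i then B else setT) => [j|]; first by case: ifP.
  rewrite setTI; apply/seteqP; split => b /=.
    by move=> bB j _ /=; case: eqP => [->|].
  by move/(_ i I) => /=; rewrite eqxx.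
apply: smallest_sub; first exact: sigma_algebra_measurable.
move=> _ [B mB ->]; apply: fin_bigcap_measurable => // i _.
by rewrite -[X in measurable X]setTI; exact: measurable_tnth.
Qed.

(** Uniqueness of measures on a pi-system: rectangles are stable under intersection, generate the
    sigma-algebra and include the whole space, which has finite measure. *)
Lemma rect_measure_unique (m1 m2 : {finite_measure set (n.-tuple R) -> \bar R}) :
  (forall B : 'I_n -> set R, (forall i, measurable (B i)) ->
    m1 (\bigcap_(i in [set: 'I_n]) (fun b => tnth b i) @^-1` B i) =
    m2 (\bigcap_(i in [set: 'I_n]) (fun b => tnth b i) @^-1` B i)) ->
  forall A, measurable A -> m1 A = m2 A.
Proof.
move=> m12; apply: (measure_unique rect (fun=> setT)) => //.
- by move=> _; exists (fun=> setT) => //; apply/seteqP; split.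
- exact: bigcup_const.
- by move=> _ [B mB ->]; exact: m12.
- by move=> _; rewrite ltey_eq fin_num_measure.
Qed.

End RectangleLaw.

(** Both sides are integrals of [f] against the laws of [a] and [b], and these laws agree on
    rectangles. *)
Lemma ge0_integral_rect {R : realType} {d} {T : measurableType d}
    (P : probability T R) {n : nat} (a b : {mfun T >-> n.-tuple R})
    (f : n.-tuple R -> \bar R) :
  measurable_fun setT f -> (forall t, (0 <= f t)%E) ->
  (forall B : 'I_n -> set R, (forall i, measurable (B i)) ->
    P (\bigcap_(i in [set: 'I_n]) (fun w => tnth (a w) i) @^-1` B i) =
    P (\bigcap_(i in [set: 'I_n]) (fun w => tnth (b w) i) @^-1` B i)) ->
  (\int[P]_w f (a w) = \int[P]_w f (b w))%E.
Proof.
move=> mf f0 ab.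
transitivity (\int[distribution P a]_t f t)%E.
  by rewrite ge0_integral_distribution.
transitivity (\int[distribution P b]_t f t)%E; last first.
  by rewrite ge0_integral_distribution.
apply: eq_measure_integral => A mA _.
exact: (rect_measure_unique (distribution P a) (distribution P b)).
Qed.

(** On every rectangle both vectors have as probability the product of the [G (B i)], up to the
    order of the factors. *)
Lemma iid_exchangeable {R : realType} {d} {T : measurableType d}
    (P : probability T R) {n : nat} (G : probability R R) (a : T -> n.-tuple R)
    (s : {perm 'I_n}) (f : n.-tuple R -> \bar R) :
  measurable_fun setT a -> indep_coords P a -> coords_distributed P a G ->
  measurable_fun setT f -> (forall t, (0 <= f t)%E) ->
  (\int[P]_w f [tuple tnth (a w) (s i) | i < n] = \int[P]_w f (a w))%E.
Proof.
move=> ma ind dist mf f0.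
pose as_ w := [tuple tnth (a w) (s i) | i < n].
have mas : measurable_fun setT as_.
  apply/measurable_fun_tnthP => i.
  rewrite (_ : _ \o _ = (fun w => tnth (a w) (s i))).
    exact: measurableT_comp (measurable_tnth _) ma.
  by apply/funext => w; rewrite /= tnth_mktuple.
apply: (ge0_integral_rect P (mfun_Sub (mem_set mas)) (mfun_Sub (mem_set ma))) => // B mB.
rewrite [RHS]ind //.
(* The permuted vector lies in a rectangle exactly when the original one lies in the rectangle with
   sides permuted by [s^-1]. *)
transitivity (P (\bigcap_(i in [set: 'I_n])
    (fun w => tnth (a w) i) @^-1` B ((s^-1)%g i))).
  congr (P _); apply/seteqP; split => w /= h i _ /=.
    by have := h ((s^-1)%g i) I; rewrite /= tnth_mktuple permKV.
  by rewrite tnth_mktuple; have := h (s i) I; rewrite /= permK.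
rewrite ind // (reindex_perm s) /=.
by apply: eq_bigr => i _; rewrite permK [LHS]dist // [RHS]dist.
Qed.

(** * Almost sure nonnegativity of the ads and the objective as an integral *)

Lemma ae_ge0_coords {R : realType} {d} {T : measurableType d}
    (P : probability T R) {n : nat} (G : probability R R) (a : T -> n.-tuple R) :
  G [set` `[0, +oo[] = 1%E -> measurable_fun setT a -> coords_distributed P a G ->
  {ae P, forall w, forall i, 0 <= tnth (a w) i}.
Proof.
move=> G0 ma dist.
have mai i : measurable_fun setT (fun w => tnth (a w) i).
  exact: measurableT_comp (measurable_tnth _) ma.
have mE i : measurable ((fun w => tnth (a w) i) @^-1` [set` `[0, +oo[]).
  by rewrite -[X in measurable X]setTI; exact: mai.
have ae_i i : {ae P, forall w, 0 <= tnth (a w) i}.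
  exists (~` ((fun w => tnth (a w) i) @^-1` [set` `[0, +oo[])); split.
  - exact: measurableC.
  - by rewrite probability_setC // dist // G0 subee.
  - by move=> w /= h; rewrite in_itv /= andbT.
by apply: filter_forall.
Qed.

(** [v] is left free to serve both for the identity, as in [OBJ], and for the absolute value. *)
Lemma measurable_value {R : realType} {d} {T : measurableType d} {n : nat}
    (a : T -> n.-tuple R) (o : 'I_n -> R) (x y : n.-tuple R -> 'I_n -> bool)
    (k : nat) (v : R -> R) :
  measurable_fun setT a -> feasible_mechanism k x y -> measurable_fun setT v ->
  measurable_fun setT (fun w => \sum_(i < n)
    (v (tnth (a w) i) * (x (a w) i)%:R + o i * (y (a w) i)%:R)).
Proof.
move=> ma [_ _ _ _ mxy] mv; apply: measurable_sum => i.
have mb (z : n.-tuple R -> 'I_n -> bool) :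
    measurable_fun setT (fun b => z b i) ->
    measurable_fun setT (fun w => (z (a w) i)%:R : R).
  move=> mz; apply: (measurableT_comp (f := fun c : bool => c%:R : R)) => //.
  exact: measurableT_comp mz ma.
apply: measurable_funD; apply: measurable_funM => //.
- exact: measurableT_comp mv (measurableT_comp (measurable_tnth _) ma).
- by apply: mb; have [] := mxy i.
- by apply: mb; have [] := mxy i.
Qed.

(** Absolute values turn almost sure nonnegativity into pointwise nonnegativity. *)
Lemma OBJ_normE {R : realType} {d} {T : measurableType d} (P : probability T R)
    {n : nat} (a : T -> n.-tuple R) (o : 'I_n -> R)
    (x y : n.-tuple R -> 'I_n -> bool) (k : nat) :
  measurable_fun setT a -> feasible_mechanism k x y ->
  {ae P, forall w, forall i, 0 <= tnth (a w) i} ->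
  OBJ P o a x y = (\int[P]_w (\sum_(i < n)
    (`|tnth (a w) i| * (x (a w) i)%:R + o i * (y (a w) i)%:R))%:E)%E.
Proof.
move=> ma feas a0; rewrite /OBJ unlock; apply: ae_eq_integral => //.
- apply/measurable_EFinP.
  exact: (measurable_value a o x y k id).
- apply/measurable_EFinP.
  exact: (measurable_value a o x y k _ ma feas (@normr_measurable _ _)).
apply: filterS a0 => w aw _; congr EFin; apply: eq_bigr => i _.
by rewrite ger0_norm.
Qed.

(** * The averaged inequality in expectation *)

(** [sum_shifts_ge] is integrated; by exchangeability each of the [m.+1] shifted values has
    expectation [OBJ_FIX]. *)
Lemma OBJ_le_OBJ_FIX {R : realType} {d} {T : measurableType d}
    (P : probability T R) {m k : nat} (G : probability R R)
    (a : T -> m.+1.-tuple R) (o : 'I_m.+1 -> R) (x y : m.+1.-tuple R -> 'I_m.+1 -> bool) :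
  (k <= m.+1)%N -> G [set` `[0, +oo[] = 1%E -> (forall i, 0 <= o i) ->
  measurable_fun setT a -> indep_coords P a -> coords_distributed P a G ->
  feasible_mechanism k x y ->
  ((m.+1 - k)%:R%:E * OBJ P o a x y <=
   m.+1%:R%:E * OBJ_FIX P k o a (topset o k))%E.
Proof.
move=> kn G0 o0 ma ind dist feas; have [xyk _ _ _ _] := feas.
have a0 := ae_ge0_coords _ _ _ G0 ma dist.
have mai i : measurable_fun setT (fun w => tnth (a w) i).
  exact: measurableT_comp (measurable_tnth _) ma.
set I := topset o k.
(* Absolute values make [h] nonnegative everywhere, as exchangeability is stated for nonnegative
   functions; [h (a w)] is almost surely the value of the mechanism fixing [I]. *)
pose h (b : m.+1.-tuple R) :=
  topk k [seq if i \in I then o i else `|tnth b i| | i <- enum 'I_m.+1].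
pose u w := \sum_(i < m.+1)
  (`|tnth (a w) i| * (x (a w) i)%:R + o i * (y (a w) i)%:R).
have topk_ge0 (f : 'I_m.+1 -> R) : (forall i, 0 <= f i) ->
    0 <= topk k [seq f i | i <- enum 'I_m.+1].
  by move=> f0; rewrite topk_map_enum sumr_ge0.
have h0 b : 0 <= h b by apply: topk_ge0 => i; case: ifP.
have mh : measurable_fun setT h.
  apply: measurable_topk => i; case: (i \in I) => //.
  exact: measurableT_comp (@normr_measurable _ _) (measurable_tnth _).
have mu := measurable_value a o x y k _ ma feas (@normr_measurable _ _).
have u0 w : 0 <= u w.
  by apply: sumr_ge0 => i _; rewrite addr_ge0 // mulr_ge0.
have OBJE := OBJ_normE P a o x y k ma feas a0.
have FIXE : OBJ_FIX P k o a I = (\int[P]_w (h (a w))%:E)%E.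
  rewrite /OBJ_FIX unlock; apply: ae_eq_integral => //.
  - apply/measurable_EFinP; apply: measurable_topk => i.
    by case: (i \in I).
  - by apply/measurable_EFinP; exact: measurableT_comp mh ma.
  apply: filterS a0 => w aw _; congr (topk _ _)%:E; apply: eq_map => i.
  by rewrite ger0_norm.
(* The shift by [j] is written as a permutation of coordinates so that [iid_exchangeable]
   applies. *)
pose hs j w := h [tuple tnth (a w) (perm (@addIr _ j) i) | i < m.+1].
have hsE j w : hs j w = topk k [seq if i \in I then o i else `|tnth (a w) (i + j)|
                               | i <- enum 'I_m.+1].
  by congr topk; apply: eq_map => i; rewrite tnth_mktuple permE.
have mhs j : measurable_fun setT (hs j).
  rewrite (funext (hsE j)).
  apply: measurable_topk => i; case: (i \in I) => //.
  exact: measurableT_comp (@normr_measurable _ _) (mai _).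
have uE w : u w =
    \sum_(i in [set i | x (a w) i]%SET) `|tnth (a w) i| +
    \sum_(i in [set i | y (a w) i]%SET) o i.
  rewrite /u big_split /=; congr (_ + _); rewrite [RHS]big_mkcond /=;
    by apply: eq_bigr => i _; rewrite inE; case: ifP => _; rewrite ?mulr1 ?mulr0.
have card_xy w : (#|[set i | x (a w) i]%SET| + #|[set i | y (a w) i]%SET| <= k)%N.
  have cardE (z : 'I_m.+1 -> bool) : #|[set i | z i]%SET| = (\sum_i z i)%N.
    rewrite cardsE -sum1_card big_mkcond; apply: eq_bigr => i _.
    by rewrite unfold_in /=; case: (z i).
  by rewrite !cardE -big_split; exact: xyk.
have -> : (m.+1%:R%:E * OBJ_FIX P k o a I =
    \int[P]_w (\sum_(j < m.+1) (hs j w)%:E))%E.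
  rewrite ge0_integral_sum //.
  - rewrite (eq_bigr (fun=> OBJ_FIX P k o a I)); last first.
      move=> j _; rewrite FIXE.
      apply: (iid_exchangeable P G a _ (fun b => (h b)%:E)) => //.
      exact/measurable_EFinP.
    by rewrite sumr_const card_ord mule_natl.
  - by move=> j; apply/measurable_EFinP.
  - by move=> j w _; rewrite lee_fin; exact: h0.
rewrite OBJE -ge0_integralZl_EFin //;
  [|by move=> w _; rewrite lee_fin; exact: u0|exact/measurable_EFinP].
apply: ge0_le_integral => //.
- by move=> w _; rewrite -EFinM lee_fin mulr_ge0 //; exact: u0.
- apply/measurable_EFinP; exact: measurable_funM.
- by apply: emeasurable_sum => j; apply/measurable_EFinP.
move=> w _; rewrite sumEFin -EFinM lee_fin -/(u w) uE (eq_bigr _ (fun j _ => hsE j w)).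
by apply: sum_shifts_ge.
Qed.

(** * Choice of [I] and the ratio [1 - eps] *)

Theorem theorem4 (R : realType) (d : measure_display) (T : measurableType d)
    (P : probability T R) (n k : nat) (eps : R)
    (G : probability R R) (a : T -> n.-tuple R) (o : 'I_n -> R) :
  0 < eps < 1 ->
  (k%:R ^+ 2 / eps + k%:R <= n%:R) ->
  regular_distribution G ->
  G [set` `[0, +oo[] = 1%E ->
  (forall i, 0 <= o i) ->
  measurable_fun setT a ->
  indep_coords P a ->
  coords_distributed P a G ->
  forall x y : n.-tuple R -> 'I_n -> bool,
    feasible_mechanism k x y ->
    ((1 - eps)%:E * OBJ P o a x y <= OBJ_GFIX P k o a)%E.
Proof.
move=> /andP[eps0 eps1] nk _ G0 o0 ma ind dist x y feas.
have kn : (k <= n)%N.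
  rewrite -(ler_nat R); apply: le_trans nk.
  by rewrite lerDr divr_ge0 ?sqr_ge0 ?ltW.
(* Since [k] is a natural number, [k <= k ^ 2], hence [k / eps <= k ^ 2 / eps <= n]. *)
have keps : k%:R <= n%:R * eps :> R.
  have k2 : k%:R <= k%:R ^+ 2 :> R.
    by rewrite -natrX ler_nat -mulnn; case: (k) => // l; rewrite leq_pmulr.
  apply: (le_trans k2); rewrite -ler_pdivrMr //.
  by apply: le_trans nk; rewrite lerDl.
(* The [k] best organic items form one of the sets over which G-FIX maximizes. *)
apply: (@le_trans _ _ (OBJ_FIX P k o a (topset o k))); last first.
  by apply: le_bigmax_cond; rewrite card_topset geq_minl.
(* Cyclic shifts require [n = m.+1]; for [n = 0] the objective is 0. *)
case: n => [|m] in a o o0 ma ind dist x y feas kn keps nk *.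
  have -> : OBJ P o a x y = 0%E.
    by rewrite /OBJ unlock; apply: integral0_eq => w _; rewrite big_ord0.
  rewrite mule0; apply: expectation_ge0 => w.
  by rewrite topk_map_enum sumr_ge0 // => -[].
have OBJ0 : (0 <= OBJ P o a x y)%E.
  rewrite (OBJ_normE P a o x y k ma feas (ae_ge0_coords _ _ _ G0 ma dist)).
  apply: integral_ge0 => w _; rewrite lee_fin; apply: sumr_ge0 => i _.
  by rewrite addr_ge0 // mulr_ge0.
(* After multiplication by [m.+1], only the coefficients of the nonnegative [OBJ] remain to be
   compared: [m.+1 * (1 - eps) <= m.+1 - k], which is [keps]. *)
rewrite -(@lee_pmul2l _ m.+1%:R%:E) ?lte_fin ?ltr0n //.
apply: le_trans (OBJ_le_OBJ_FIX P G a o x y kn G0 o0 ma ind dist feas).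
rewrite muleA -EFinM lee_wpmul2r // lee_fin natrB // mulrBr mulr1.
by rewrite lerB.
Qed.
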